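(* Let $\Gamma$ be the sub-algebra of $M_2(\mathbb{C})[x]$ consisting of the polynomials of the form $$\begin{pmatrix} r_0^{11}&r_0^{12}\\ 0&r_0^{11}\end{pmatrix}+\begin{pmatrix} r_1^{11}&r_1^{12}\\ 0&r_1^{11}\end{pmatrix}x+\begin{pmatrix} r_2^{11}&r_2^{12}\\ r_1^{11}&r_2^{22}\end{pmatrix}x^2+\begin{pmatrix} r_3^{11}&r_3^{12}\\ r_2^{22}+r_2^{11}-r_1^{12}&r_3^{22}\end{pmatrix}x^3+x^4p(x),$$ where $p\in M_2(\mathbb{C})[x]$ and all the variables $r_0^{11},r_0^{12},r_1^{11},r_1^{12},r_2^{11},r_2^{12},r_2^{22},r_3^{11},r_3^{12},r_3^{22}\in\mathbb{C}$ are arbitrary. Then $\Gamma=\mathbb{A}$. Moreover, for each $\theta\in\Gamma$ there is an explicit expression for the operator $\mathcal{B}$: if $\theta(x)=\sum_{j=0}^{M}a_jx^j\in\Gamma$, then $$\mathcal{B}=\sum_{j=0}^{M}\partial_z^j\cdot\Big(a_j+\sum_{l=1}^{M-j}\frac{(-1)^l}{z^l}\sum_{r=j+l-1}^{M}(\mu^{l-1})_{jr}\,S^{r-j-l+1}P_r(\theta)\Big)$$ satisfies $(\psi\mathcal{B})(x,z)=\theta(x)\psi(x,z)$, where $\mu$ is the $(M+1)\times(M+1)$ matrix with entries indexed by $0\le r,j\le M$ given by $\mu_{rj}=(-1)^{r-j}$ if $r+2\le j\le\min\{r+2,M\}$, $\mu_{rj}=r$ if $j=r+1$, and $\mu_{rj}=0$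 otherwise.
   Context: $S=\begin{pmatrix}0&1\\ 0&0\end{pmatrix}$, $S^0=I$, $[X,Y]=XY-YX$. For $k\in\mathbb{N}=\{0,1,2,\dots\}$ and $\theta\in M_2(\mathbb{C}[x])$, $P_k(\theta)=\frac{\theta^{(k+1)}(0)}{k!}-\big[\frac{\theta^{(k+2)}(0)}{(k+2)!},S\big]$. Let $\psi(x,z)=e^{xz}\big(Iz-Ix^{-1}+Sx^{-2}\big)$, for $x\in\mathbb{C}\setminus\{0\}$, $z\in\mathbb{C}$. A differential operator $\mathcal{B}=\mathcal{B}(z,\partial_z)=\sum_{j=0}^{m}\partial_z^j\cdot b_j(z)$ (with $b_j$ $2\times2$ matrix valued meromorphic functions on a suitable nonempty connected open subset of $\mathbb{C}$) acts on $\psi$ from the right by $\psi\mathcal{B}=\sum_{j=0}^{m}(\partial_z^j\psi)\,b_j(z)$, and $$\mathbb{A}=\{\theta\in M_2(\mathbb{C}[x])\mid \exists\,\mathcal{B}=\mathcal{B}(z,\partial_z):\ (\psi\mathcal{B})(x,z)=\theta(x)\psi(x,z)\}.$$ *)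

(* Defs.v *)
From mathcomp Require Import all_boot all_order all_algebra.
From mathcomp Require Import all_classical all_reals all_analysis.
From mathcomp Require Import complex.
Import numFieldNormedType.Exports.

Set Implicit Arguments.
Unset Strict Implicit.
Unset Printing Implicit Defensive.

Import Order.TTheory GRing.Theory Num.Theory.

Local Open Scope classical_set_scope.
Local Open Scope ring_scope.

(* Matrix polynomials M_2(C)[x] = M_2(C[x]) are [{poly 'M[C]_2}], in which
   the indeterminate is central, so that the value of theta at a complex
   number x is [theta.[x%:M]]. *)

(* R[i] seen as a numFieldType, which equips it with the topology and the
   normed module structure given by the modulus. *)
Definition cplx (R : realType) : numFieldType := R[i].

Section ComplexAnalysis.
Variable R : realType.
Local Notation C := (cplx R).

Definition expC (z : C) : C :=
  (expR (complex.Re z) * cos (complex.Im z)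
   +i* (expR (complex.Re z) * sin (complex.Im z)))%C.

(* [derivable] is taken over the scalar field C, hence is complex
   differentiability. *)
Definition holomorphic_at (W : normedModType C) (f : C -> W)
    (a : C) : Prop :=
  \forall z \near a, derivable f z 1.

(* The value f a itself is irrelevant: a may be a pole, where the total
   function f takes an arbitrary value. *)
Definition meromorphic_at (W : normedModType C) (f : C -> W)
    (a : C) : Prop :=
  exists (n : nat) (g : C -> W),
    holomorphic_at g a /\ \forall z \near a^', (z - a) ^+ n *: f z = g z.

Definition meromorphic_on (W : normedModType C) (U : set C)
    (f : C -> W) : Prop :=
  forall a, U a -> meromorphic_at f a.

End ComplexAnalysis.

Section Bispectral.
Variable R : realType.
Local Notation C := (cplx R).
Local Notation M2 := 'M[cplx R]_2.

Definition mx2 (a b c d : C) : M2 :=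
  \matrix_(i, j) if i == 0 then (if j == 0 then a else b)
                 else (if j == 0 then c else d).

Definition Smx : M2 := mx2 0 1 0 0.

Definition commutator (X Y : M2) : M2 := X * Y - Y * X.

Definition Pcoef (k : nat) (theta : {poly M2}) : M2 :=
  (k`!%:R : C)^-1 *: (derivn k.+1 theta).[0]
  - commutator (((k.+2)`!%:R : C)^-1 *: (derivn k.+2 theta).[0]) Smx.

Definition psi (x z : C) : M2 :=
  expC (x * z) *: (z%:M - (x^-1)%:M + x ^- 2 *: Smx).

(* A differential operator sum_(j <= m) d_z^j . b_j(z) is given by its order
   bound m, its coefficients b_j and a domain U on which they are
   meromorphic. *)
Definition is_diffop (U : set C) (m : nat) (b : 'I_m.+1 -> C -> M2) : Prop :=
  [/\ open U, U !=set0, connected U &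
      forall j, meromorphic_on U (b j)].

Definition psi_act (m : nat) (b : 'I_m.+1 -> C -> M2) (x z : C) : M2 :=
  \sum_(j < m.+1) derive1n j (psi x) z * b j z.

(* Points of the domain that are not poles of the operator. *)
Definition regular_point (m : nat) (b : 'I_m.+1 -> C -> M2) (z : C) : Prop :=
  forall j, holomorphic_at (b j) z.

Definition bispectral_algebra : set {poly M2} :=
  [set theta | exists (U : set C) (m : nat) (b : 'I_m.+1 -> C -> M2),
    is_diffop U b /\
    forall x z : C, x != 0 -> U z -> regular_point b z ->
      psi_act b x z = theta.[x%:M] * psi x z].

Definition Gamma : set {poly M2} :=
  [set theta | exists (r0_11 r0_12 r1_11 r1_12 r2_11 r2_12 r2_22
                       r3_11 r3_12 r3_22 : C) (p : {poly M2}),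
    theta = (mx2 r0_11 r0_12 0 r0_11)%:P
          + (mx2 r1_11 r1_12 0 r1_11)%:P * 'X
          + (mx2 r2_11 r2_12 r1_11 r2_22)%:P * 'X^2
          + (mx2 r3_11 r3_12 (r2_22 + r2_11 - r1_12) r3_22)%:P * 'X^3
          + 'X^4 * p].

(* C-subalgebra of M_2(C)[x]; the scalar c acts as multiplication by the
   constant polynomial c I. *)
Definition is_subalgebra (G : set {poly M2}) : Prop :=
  [/\ G 1,
      forall (c : C) p q, G p -> G q -> G ((c%:M : M2)%:P * p + q) &
      forall p q, G p -> G q -> G (p * q)].

Definition mumx (M : nat) : 'M[C]_M.+1 :=
  \matrix_(r, j) if (r + 2 <= j <= minn (r + 2) M)%N
                 then (-1) ^ (r%:Z - j%:Z)
                 else if j == (r + 1)%N :> nat then (r : nat)%:R else 0.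

(* The exponent r - j - l + 1 >= 0 is written (r + 1) - (j + l), so that no
   truncation of natural number subtraction occurs. *)
Definition Bcoef (M : nat) (a : nat -> M2) (theta : {poly M2})
    (j : 'I_M.+1) (z : C) : M2 :=
  a j + \sum_(1 <= l < (M - j).+1)
    ((-1) ^+ l / z ^+ l) *:
      \sum_(r < M.+1 | (j + l - 1 <= r)%N)
        (mumx M ^+ (l - 1)) j r *: (Smx ^+ ((r + 1) - (j + l)) * Pcoef r theta).

End Bispectral.

(* Main.v *)
Require Import Defs.
From mathcomp Require Import all_boot all_order all_algebra.
From mathcomp Require Import all_classical all_reals all_analysis.
From mathcomp Require Import complex ring lra.
Import numFieldNormedType.Exports.

Set Implicit Arguments.
Unset Strict Implicit.
Unset Printing Implicit Defensive.

Import Order.TTheory GRing.Theory Num.Theory.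

Local Open Scope classical_set_scope.
Local Open Scope ring_scope.

(** Dropping the exponential, the j-th z-derivative of [psi x z] is
    [z x^j + (j-1) x^(j-1) + S x^(j-2)]. For a fixed z the equation
    psi B = theta psi is therefore an identity between Laurent polynomials in x,
    and after multiplication by x^2 an identity in [{poly 'M_2}] (lemma
    [psi_act_eqP]). Write [b_k = a_k + c_k], where the [a_k] are the
    coefficients of theta. Comparing coefficients (lemma [symbolP]) turns the
    identity into the recursion [z c_k + (N c)_k = - P_k(theta)], with
    [(N c)_k = k c_(k+1) + S c_(k+2)] ([shift_op]), and the two boundary conditions
    [S c_0 = [a_0, S]] and [S c_1 - c_0 = [a_1, S]].

    Since S^2 = 0, the recursion for k = 0 and k = 1 computes the left-hand sides
    of the boundary conditions: they hold exactly when
    [z [a_0, S] = - S P_0] and [z [a_1, S] = P_0 - S P_1]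
    (lemma [symbol_obstruction]). The coefficients of an operator are
    meromorphic, so all of them are regular in a punctured neighbourhood of
    any point of the domain; using the equation at two values of z gives
    [[a_0, S] = [a_1, S] = 0] and [P_0 = S P_1]. Entry by entry these relations
    are the description of Gamma (lemmas [gamma_relationsP] and [GammaP]).

    Conversely N is nilpotent on sequences vanishing from some index on, so
    for z <> 0 the recursion has the solution
    [c = - (z + N)^-1 P = \sum_(l >= 1) (-1)^l z^-l N^(l-1) P]
    (lemma [correctionP]), and the relations of Gamma give the boundary
    conditions. In an entry of a power of mu, every step by 2 goes with
    one factor S of N; this identifies c with the stated
    coefficients (lemmas [mumx_expE] and [BcoefE]), which are Laurent
    polynomials in z.

    On the analytic side what is needed is that the complex exponential
    [expC] is its own complex derivative (lemmas [expC_first_order] and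
    [derive1n_psi]). The inclusion of Gamma in the algebra
    uses the domain [ball 1 1], which avoids z = 0. *)

(** * The relations of Gamma in an algebra with a square-zero element *)

Lemma eq_iff_of_subr (V : zmodType) (a b c d : V) :
  a - b = c - d -> (a = b <-> c = d).
Proof.
move=> e; split=> /eqP; rewrite -subr_eq0 => h; apply/eqP; rewrite -subr_eq0.
  by rewrite -e.
by rewrite e.
Qed.

Section SquareZero.
Variables (K : fieldType) (A : algType K) (s : A).
Hypothesis s_sqr : s * s = 0.
Implicit Types (theta b p q : {poly A}) (x z : K).

(** The coordinate-free form of Gamma, in which [s] stands for the matrix S. *)
Definition gamma_relations theta : Prop :=
  [/\ theta`_0 * s = s * theta`_0, theta`_1 * s = s * theta`_1 &
      theta`_1 = theta`_2 * s + s * theta`_2 - s * theta`_3 * s].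

Lemma gamma_relations1 : gamma_relations 1.
Proof.
by split; rewrite !coefC /= !(mul1r, mulr1, mul0r, mulr0, subr0, addr0).
Qed.

Lemma gamma_relations_scale c p q :
  gamma_relations p -> gamma_relations q -> gamma_relations ((c *: 1)%:P * p + q).
Proof.
move=> [p0 p1 p2] [q0 q1 q2].
rewrite /gamma_relations !coefD !coefCM -!scalerAl !mul1r.
rewrite !mulrDl !mulrDr -!scalerAl -!scalerAr p0 p1 q0 q1.
split=> //; rewrite {1}p2 {1}q2 !mulrDl -!scalerAl.
rewrite !scalerDr scalerN opprD addrACA; congr (_ + _).
by rewrite addrACA.
Qed.

(** Multiplying the last relation by [s] on either side gives
    [s a_1 = s a_2 s] and [a_1 s = s a_2 s]; with these the cross terms
    [a_1 b_1] on one side and [s (a_1 b_2 + a_2 b_1) s] on the other cancel. *)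
Lemma gamma_relations_mul p q :
  gamma_relations p -> gamma_relations q -> gamma_relations (p * q).
Proof.
move=> [p0 p1 p2] [q0 q1 q2].
rewrite /gamma_relations !coefM !big_ord_recl !big_ord0 /= !addr0.
rewrite /bump /= !(subnS, subn0) /= !add1n /=.
move: p2 q2; set a0 := p`_0; set a1 := p`_1; set a2 := p`_2; set a3 := p`_3.
set b0 := q`_0; set b1 := q`_1; set b2 := q`_2; set b3 := q`_3.
rewrite -/a0 -/a1 -/b0 -/b1 in p0 p1 q0 q1 *.
move=> p2 q2.
have sa1 : s * a1 = s * a2 * s.
  by rewrite {1}p2 !mulrDr mulrN !mulrA s_sqr !mul0r subr0 addr0.
have b1s : b1 * s = s * b2 * s.
  by rewrite {1}q2 !mulrDl mulNr -!mulrA s_sqr !mulr0 subr0 add0r.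
split.
- by rewrite -mulrA q0 mulrA p0 mulrA.
- by rewrite mulrDl mulrDr -!mulrA q0 q1 !mulrA p0 p1.
have a0b1 : a0 * b1 = a0 * b2 * s + s * a0 * b2 - s * a0 * b3 * s.
  by rewrite {1}q2 !mulrDr mulrN -p0 !mulrA.
have a1b0 : a1 * b0 = a2 * b0 * s + s * a2 * b0 - s * a3 * b0 * s.
  by rewrite {1}p2 !mulrDl mulNr -!mulrA -q0.
have e1 : a1 * b1 * s = s * a2 * b1 * s.
  by rewrite -mulrA q1 mulrA p1 sa1 -!mulrA q1.
have e2 : s * a1 * b1 = s * a1 * b2 * s.
  by rewrite -p1 -!mulrA -q1 b1s !mulrA.
rewrite a0b1 a1b0 !mulrDr !mulrDl !mulrA e1 e2 !opprD.
(* The permutation puts the two cancelling pairs of terms last. *)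
rewrite [RHS]addrA !addrA [RHS](+%R.[ACl 1*4*7*3*6*10*(5*8)*(2*9)]) !subrr.
by rewrite !addr0.
Qed.

(** * The bispectral equation as a polynomial identity *)

(** [psi x z] is [exp (x z) / x^2] times the value at [x] of this polynomial. *)
Definition wave_poly z : {poly A} := (z *: 1)%:P * 'X^2 - 'X + s%:P.

(** When the coefficients of [b] are the [b_j(z)], this is the polynomial in [x]
    whose value is [x^2 exp (- x z)] times [psi] acted upon by the operator. *)
Definition symbol z b : {poly A} :=
  (z *: 1)%:P * 'X^2 * b + 'X^2 * b^`() - 'X * b + s%:P * b.

(** The sequence [Pcoef], with the derivatives at 0 read off as coefficients. *)
Definition Pseq theta k : A := theta`_k.+1 *+ k.+1 - (theta`_k.+2 * s - s * theta`_k.+2).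

Definition shift_op (v : nat -> A) k : A := v k.+1 *+ k + s * v k.+2.

(** The three clauses are the coefficients of degrees 0, 1 and k + 2. *)
Lemma symbolP z theta b c : (forall k, b`_k = theta`_k + c k) ->
  symbol z b = theta * wave_poly z <->
  [/\ s * c 0%N = theta`_0 * s - s * theta`_0,
      s * c 1%N - c 0%N = theta`_1 * s - s * theta`_1 &
      forall k, z *: c k + shift_op c k = - Pseq theta k].
Proof.
move=> bE; have cb k : c k = b`_k - theta`_k by rewrite bE addrC addKr.
have LE k : (symbol z b)`_k = (if (k < 2)%N then 0 else z *: b`_(k - 2))
  + (if (k < 2)%N then 0 else b`_(k - 2).+1 *+ (k - 2).+1)
  - (if k == 0%N then 0 else b`_k.-1) + s * b`_k.
  rewrite /symbol !coefD coefN -mulrA !coefCM !coefXnM coefXM coef_deriv.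
  by case: ifP => _; rewrite ?mulr0 // -scalerAl mul1r.
have RE k : (theta * wave_poly z)`_k = (if (k < 2)%N then 0 else z *: theta`_(k - 2))
  - (if k == 0%N then 0 else theta`_k.-1) + theta`_k * s.
  rewrite /wave_poly mulrDr mulrBr !coefD coefN mulrA coefMXn coefMX !coefMC.
  by case: ifP => _ //; rewrite -scalerAr mulr1.
have cE k : z *: c k + shift_op c k = - Pseq theta k <->
    (symbol z b)`_k.+2 = (theta * wave_poly z)`_k.+2.
  rewrite LE RE /= subn2 /= /shift_op /Pseq !cb.
  apply: eq_iff_of_subr; rewrite scalerBr mulrBr mulrnBl !mulrS !(opprD, opprK) !addrA.
  rewrite [LHS](+%R.[ACl 1*2*3*5*7*9*(8*4)*(10*6)]).
  by rewrite [RHS](+%R.[ACl 1*6*3*5*7*8*(2*4)]) !subrr !addr0.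
have cE1 : s * c 1%N - c 0%N = theta`_1 * s - s * theta`_1 <->
    (symbol z b)`_1 = (theta * wave_poly z)`_1.
  rewrite LE RE /= !(addr0, add0r, subr0) !cb.
  apply: eq_iff_of_subr; rewrite mulrBr !(opprD, opprK) !addrA.
  by rewrite [LHS](+%R.[ACl 3*1*4*5*(6*2)]) !subrr addr0.
have cE0 : s * c 0%N = theta`_0 * s - s * theta`_0 <->
    (symbol z b)`_0 = (theta * wave_poly z)`_0.
  rewrite LE RE /= !(addr0, add0r, subr0) !cb.
  apply: eq_iff_of_subr; rewrite mulrBr !(opprD, opprK) !addrA.
  by rewrite [LHS](+%R.[ACl 1*3*(4*2)]) !subrr !addr0.
split=> [e|[e0 e1 e2]].
  by split=> [||k]; [apply/cE0|apply/cE1|apply/cE]; rewrite e.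
by apply/polyP => -[|[|k]]; [apply/cE0|apply/cE1|apply/cE].
Qed.

Lemma gamma_relationsP theta :
  gamma_relations theta <->
  [/\ theta`_0 * s = s * theta`_0, theta`_1 * s = s * theta`_1 &
      Pseq theta 0 = s * Pseq theta 1].
Proof.
have e : theta`_1 - (theta`_2 * s + s * theta`_2 - s * theta`_3 * s) =
    Pseq theta 0 - s * Pseq theta 1.
  rewrite /Pseq !mulrBr mulr1n mulr2n mulrDr !(mulrA s s) s_sqr mul0r subr0 !mulrA.
  rewrite !(opprD, opprK) !addrA.
  by rewrite [RHS](+%R.[ACl 1*2*4*6*(3*5)]) subrr addr0.
by split=> -[h0 h1 h2]; split=> //; apply/(eq_iff_of_subr e).
Qed.

(** The recursion at 0, and [s] times the recursion at 1, express
    [z s c_0] and [z (s c_1 - c_0)] through the [P_k], because the terms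
    in [s * s] vanish and those in [s c_2] cancel. *)
Lemma symbol_obstruction z theta b : symbol z b = theta * wave_poly z ->
  z *: (theta`_0 * s - s * theta`_0) = - (s * Pseq theta 0) /\
  z *: (theta`_1 * s - s * theta`_1) = Pseq theta 0 - s * Pseq theta 1.
Proof.
have bE k : b`_k = theta`_k + (b - theta)`_k by rewrite -coefD addrC subrK.
move=> /(symbolP z bE); move: (polyseq (b - theta)) => c [<- <- e].
have := e 0%N; have := e 1%N; rewrite /shift_op /= mulr0n mulr1n add0r => e1 e0.
split.
  by rewrite -mulrN -e0 mulrDr mulrA s_sqr mul0r addr0 scalerAr.
rewrite -[Pseq theta 0]opprK -e0 -mulrN -e1 !mulrDr !mulrA s_sqr mul0r addr0.
rewrite scalerBr scalerAr opprD !addrA.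
by rewrite [RHS](+%R.[ACl 3*1*(4*2)]) subrr addr0.
Qed.

(** The obstructions are affine in [z], so two values of [z] separate the
    commutators from the terms in [P_0] and [P_1]. *)
Lemma gamma_relations_of_symbol z1 z2 theta b1 b2 : z1 != 0 -> z1 != z2 ->
  symbol z1 b1 = theta * wave_poly z1 -> symbol z2 b2 = theta * wave_poly z2 ->
  gamma_relations theta.
Proof.
move=> z10 z12 /symbol_obstruction [e0 e1] /symbol_obstruction [_ e2].
have c1 : theta`_1 * s - s * theta`_1 = 0.
  apply: (@scalerI _ _ (z1 - z2)); first by rewrite subr_eq0.
  by rewrite scalerBl e1 e2 subrr scaler0.
have P01 : Pseq theta 0 = s * Pseq theta 1.
  by apply/eqP; rewrite -subr_eq0 -e1 c1 scaler0.
apply/gamma_relationsP; split=> //; apply/eqP; rewrite -subr_eq0; apply/eqP=> //.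
by apply: (scalerI z10); rewrite e0 P01 mulrA s_sqr mul0r oppr0 scaler0.
Qed.

(** * Solving the recursion *)

(** Each application of the operator shifts the index upwards by at least 1. *)
Lemma iter_shift_op_eq0 (P : nat -> A) M n k :
  (forall i, (M <= i)%N -> P i = 0) -> (M <= k + n)%N -> iter n shift_op P k = 0.
Proof.
move=> P0; elim: n k => [|n IH] k; first by rewrite addn0 => /P0.
rewrite addnS => kn; rewrite iterS /shift_op !IH ?mulr0 ?mul0rn ?addr0 // !addSn //.
exact: leqW.
Qed.

(** The truncated Neumann series of [- (z + N)^-1 P]. *)
Definition correction (P : nat -> A) z M k : A :=
  \sum_(n < M) ((-1) ^+ n.+1 / z ^+ n.+1) *: iter n shift_op P k.

(** The sum telescopes, and the only remaining term other than [- P k] is the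
    one in [N^M P], which vanishes. *)
Lemma correctionP (P : nat -> A) z M k : z != 0 ->
  (forall i, (M <= i)%N -> P i = 0) ->
  z *: correction P z M k + shift_op (correction P z M) k = - P k.
Proof.
move=> z0 P0.
pose u n := ((-1) ^+ n / z ^+ n) *: iter n shift_op P k.
have -> : z *: correction P z M k = - \sum_(n < M) u n.
  rewrite scaler_sumr -sumrN; apply: eq_bigr => n _.
  rewrite /u scalerA -scaleNr; congr (_ *: _).
  by rewrite !exprS; field; rewrite expf_neq0.
have -> : shift_op (correction P z M) k = \sum_(n < M) u n.+1.
  rewrite /shift_op /correction mulr_sumr -sumrMnl -big_split; apply: eq_bigr => n _ /=.
  by rewrite /u iterS /shift_op scalerDr scalerMnr scalerAr.
rewrite addrC -sumrB -(big_mkord xpredT (fun n => u n.+1 - u n)) telescope_sumr //.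
by rewrite /u (iter_shift_op_eq0 P0) ?leq_addl // scaler0 sub0r divr1 scale1r.
Qed.
Lemma gamma_relations_symbol z M theta b : z != 0 -> gamma_relations theta ->
  (forall i, (M <= i)%N -> Pseq theta i = 0) ->
  (forall k, b`_k = theta`_k + correction (Pseq theta) z M k) ->
  symbol z b = theta * wave_poly z.
Proof.
move=> z0 /gamma_relationsP[c0 c1 P01] P0 bE; apply/(symbolP z bE).
have e k := correctionP k z0 P0.
have := e 0%N; have := e 1%N; rewrite /shift_op mulr0n mulr1n add0r => e1 e0.
have sc1 : correction (Pseq theta) z M 0 = s * correction (Pseq theta) z M 1.
  apply: (scalerI z0); apply: (addIr (s * correction (Pseq theta) z M 2)).
  by rewrite e0 P01 -mulrN -e1 !mulrDr !mulrA s_sqr mul0r addr0 scalerAr.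
by split=> //; rewrite ?c0 ?c1 sc1 ?mulrA ?s_sqr ?mul0r !subrr.
Qed.

(** * Evaluation at scalars *)

Lemma comm_poly_scalar p x : comm_poly p (x *: 1 : A).
Proof. by rewrite /comm_poly -scalerAr mulr1 -scalerAl mul1r. Qed.

Lemma horner_scalarM p q x :
  (p * q).[x *: 1] = p.[x *: 1] * q.[x *: 1].
Proof. exact/hornerM_comm/comm_poly_scalar. Qed.

Lemma horner_wave x z :
  (wave_poly z).[x *: 1] = (z * x ^+ 2) *: 1 - x *: 1 + s.
Proof.
rewrite /wave_poly !hornerD hornerN horner_scalarM !hornerC hornerX hornerXn.
by rewrite exprZn expr1n -scalerAl mul1r scalerA.
Qed.

Lemma horner_symbol x z b :
  (symbol z b).[x *: 1] = (z * x ^+ 2 - x) *: b.[x *: 1] +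
    x ^+ 2 *: b^`().[x *: 1] + s * b.[x *: 1].
Proof.
rewrite /symbol !hornerD hornerN !horner_scalarM !hornerC !hornerX.
have mA (k : K) (y : A) : k%:A * y = k *: y by rewrite -scalerAl mul1r.
rewrite !(mA x x%:A) !(mA z) !scalerA -expr2 !mA scalerBl.
by rewrite -mulrA -expr2; congr (_ + _); rewrite addrAC.
Qed.

Lemma horner_poly_scalar n (b : nat -> A) x :
  (\poly_(j < n) b j).[x *: 1] = \sum_(j < n) x ^+ j *: b j.
Proof.
rewrite horner_poly; apply: eq_bigr => j _.
by rewrite exprZn expr1n -scalerAr mulr1.
Qed.

Lemma horner_deriv_poly_scalar n (b : nat -> A) x :
  (\poly_(j < n) b j)^`().[x *: 1] = \sum_(j < n) (j%:R * x ^+ j.-1) *: b j.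
Proof.
rewrite poly_def raddf_sum horner_sum; apply: eq_bigr => j _.
rewrite /= derivZ derivXn hornerZ hornerMn hornerXn exprZn expr1n.
by rewrite mulrnAr -scalerAr mulr1 -scaler_nat scalerA.
Qed.

Lemma scaled_wave (e x z : K) : x != 0 ->
  e *: (z%:A - x^-1%:A + x ^- 2 *: s) = (e / x ^+ 2) *: (wave_poly z).[x%:A].
Proof.
move=> x0; rewrite horner_wave -[RHS]scalerA; congr (_ *: _).
rewrite scalerDr scalerBr !scalerA; congr (_ *: _ - _ *: _ + _).
  by field.
by field.
Qed.

Lemma scaled_symbol (e x z : K) n (b : nat -> A) : x != 0 ->
  \sum_(j < n) e *: (z *: (x ^+ j)%:A + (x ^+ j *: (- x^-1%:A + x ^- 2 *: s) +
                     (j%:R * x ^+ j.-1)%:A)) * b j =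
  (e / x ^+ 2) *: (symbol z (\poly_(j < n) b j)).[x%:A].
Proof.
move=> x0; rewrite horner_symbol horner_poly_scalar horner_deriv_poly_scalar.
rewrite !scaler_sumr mulr_sumr -!big_split /= scaler_sumr; apply: eq_bigr => j _.
rewrite -[RHS]scalerA -scalerAl; congr (_ *: _).
move: (b j) => B.
rewrite [x ^+ j *: (_ + _)]scalerDr scalerN !mulrDl mulNr -!scalerAl !mul1r !scalerA.
rewrite -scaleNr -[- _ *: _ + _ + _]addrA [X in - _ *: _ + X]addrC !addrA -!scalerDl.
rewrite -scalerAr scalerDr !scalerA; congr (_ *: _ + _ *: _); last by rewrite mulrC.
by field.
Qed.

End SquareZero.

(** * Powers of the matrix mu *)

Section MuPowers.
Variable R : realType.
Local Notation C := (cplx R).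
Variables (A : algType C) (s : A) (P : nat -> A) (M : nat).
Hypothesis P0 : forall k, (M <= k)%N -> P k = 0.

Lemma mumxE (j k : 'I_M.+1) :
  mumx R M j k = (k == j.+2 :> nat)%:R + (j : nat)%:R *+ (k == j.+1 :> nat).
Proof.
rewrite mxE addn2 addn1 leq_min; case: (eqVneq (k : nat) j.+2) => [kj|kj].
  rewrite (_ : (_ && _) = true); last by rewrite kj !leqnn -kj -ltnS ltn_ord.
  rewrite (gtn_eqF (_ : j.+1 < k)%N) ?kj // mulr0n addr0.
  by rewrite -addn2 PoszD opprD addrA subrr sub0r -exprnN sqrrN expr1n invr1.
rewrite add0r (_ : (_ && _) = false); first by case: eqP.
by apply: contra_neqF kj => /andP[k1 /andP[k2 _]]; apply/eqP; rewrite eqn_leq k1 k2.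
Qed.

Lemma mumx_exp_upper n (j r : 'I_M.+1) :
  (r < j + n)%N -> (mumx R M ^+ n) j r = 0.
Proof.
elim: n j => [|n IH] j.
  by rewrite addn0 expr0 mxE => rj; rewrite -val_eqE gtn_eqF.
rewrite exprS mxE => rj; apply: big1 => k _; rewrite mumxE.
have [kj|kj] := ltnP j k.
  by rewrite IH ?mulr0 // (leq_trans rj) // addnS -addSn leq_add2r.
by rewrite !ltn_eqF ?add0r ?mulr0n ?mul0r // ltnW.
Qed.

(** [mu^n] counts weighted paths with n steps of length 1 or 2. A path from j
    to r has r - (j + n) steps of length 2, which is also the number of
    factors [s] that it contributes to the n-th power of N. *)
Lemma mumx_expE n (j : 'I_M.+1) :
  \sum_(r < M.+1 | (j + n <= r)%N)
     (mumx R M ^+ n) j r *: (s ^+ (r - (j + n)) * P r) =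
  iter n (shift_op s) P j.
Proof.
elim: n j => [|n IH] j.
  rewrite addn0 (bigD1 j) //= expr0 mxE eqxx scale1r subnn mul1r.
  rewrite big1 ?addr0 // => r /andP[_ rj]; rewrite mxE eq_sym (negPf rj) scale0r //.
pose v := iter n (shift_op s) P.
have v0 k : (M < k)%N -> v k = 0.
  by move=> Mk; apply: (iter_shift_op_eq0 s P0); rewrite (leq_trans (ltnW Mk)) ?leq_addr.
transitivity (\sum_(k < M.+1)
    ((if k == j.+2 :> nat then s * v k else 0) +
     (if k == j.+1 :> nat then v k *+ j else 0))); last first.
  rewrite big_split /= -!big_mkcond /= (big_ord1_eq _ (fun k => s * v k)).
  rewrite (big_ord1_eq _ (fun k => v k *+ j)).
  rewrite /shift_op -/v addrC !ltnS.
  by congr (_ + _); case: ltnP => // h; rewrite v0 // ?mulr0 ?mul0rn.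
under eq_bigr => r _ do rewrite exprS mxE scaler_suml.
rewrite exchange_big /=; apply: eq_bigr => k _.
under eq_bigr => r _ do rewrite -scalerA.
rewrite -scaler_sumr mumxE scalerDl; congr (_ + _).
  case: eqP => kj; last by rewrite scale0r.
  rewrite scale1r /v -IH mulr_sumr (bigID (fun r : 'I__ => (k + n <= r)%N)) /=.
  rewrite [X in _ + X]big1 ?addr0 => [|r /andP[_]]; last first.
    by rewrite -ltnNge => /mumx_exp_upper ->; rewrite scale0r.
  (* The lower bound on r may be raised by 1: the entries of [mu^n] in row
     j + 2 vanish at r = j + n + 1. *)
  rewrite (eq_bigl (fun r : 'I_M.+1 => (k + n <= r)%N)) => [|r]; last first.
    rewrite andb_idl // kj addSnnS addSn => /ltnW //.
  apply: eq_bigr => r; rewrite kj => kr.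
  have -> : (r - (j + n.+1) = (r - (j.+2 + n)).+1)%N.
    by rewrite -subSn // addnS !addSn subSS.
  by rewrite -scalerAr exprS mulrA.
case: eqP => kj; last by rewrite mulr0n scale0r.
by rewrite mulr1n scaler_nat /v -IH kj !addSnnS.
Qed.

End MuPowers.

Section OperatorCoefficients.
Variable R : realType.
Local Notation C := (cplx R).
Local Notation M2 := 'M[cplx R]_2.
Local Notation S := (Smx R).

Lemma PcoefE k (theta : {poly M2}) : Pcoef k theta = Pseq S theta k.
Proof.
have fact_neq0 n : (n`!)%:R != 0 :> C by rewrite pnatr_eq0 -lt0n fact_gt0.
have coefdn n : (derivn n theta).[0] = (n`!)%:R *: theta`_n.
  by rewrite horner_coef0 coef_derivn addn0 ffactnn scaler_nat.
rewrite /Pcoef /Pseq /commutator !coefdn !scalerA mulVf ?fact_neq0 // scale1r.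
by rewrite factS natrM mulrCA mulVf ?fact_neq0 // mulr1 scaler_nat.
Qed.

(** The stated sum over l stops at M - j, the Neumann series at M; the
    difference consists of zero terms. *)
Lemma BcoefE (M : nat) (a : nat -> M2) (theta : {poly M2}) (j : 'I_M.+1) z :
  (forall k, (M < k)%N -> theta`_k = 0) ->
  Bcoef a theta j z = a j + correction S (Pseq S theta) z M j.
Proof.
move=> th0; rewrite /Bcoef; congr (_ + _).
have P0 k : (M <= k)%N -> Pseq S theta k = 0.
  by move=> Mk; rewrite /Pseq !th0 ?mul0rn ?mul0r ?mulr0 ?subr0 // ltnW.
rewrite big_add1 /= /correction [RHS](bigID (fun n : 'I_M => (n < M - j)%N)) /=.
rewrite [X in _ = _ + X]big1 ?addr0 => [|n]; last first.
  rewrite -leqNgt leq_subLR => jn.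
  by rewrite (iter_shift_op_eq0 _ P0) ?scaler0.
rewrite -(big_ord_widen _ (fun n => ((-1) ^+ n.+1 / z ^+ n.+1) *:
  iter n (shift_op S) (Pseq S theta) j)) ?leq_subr // big_mkord.
apply: eq_bigr => n _; congr (_ *: _).
rewrite -mumx_expE //; apply: eq_big => r.
  by rewrite addnS subn1.
by move=> _; rewrite subn1 addn1 addnS subSS PcoefE.
Qed.

End OperatorCoefficients.

Lemma coef_cubic_head (T : nzRingType) (c0 c1 c2 c3 : T) (p : {poly T})
    (t := c0%:P + c1%:P * 'X + c2%:P * 'X^2 + c3%:P * 'X^3 + 'X^4 * p) :
  [/\ t`_0 = c0, t`_1 = c1, t`_2 = c2 & t`_3 = c3].
Proof.
by split; rewrite /t !coefD coefXnM coefMX !coefMXn !coefC /= ?addr0 ?add0r.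
Qed.

Lemma poly_cubic_head (T : nzRingType) (t : {poly T}) :
  t = (t`_0)%:P + (t`_1)%:P * 'X + (t`_2)%:P * 'X^2 + (t`_3)%:P * 'X^3 +
      'X^4 * drop_poly 4 t.
Proof.
rewrite -[LHS](poly_take_drop 4) -commr_polyXn; congr (_ + _).
apply/polyP => i; rewrite coef_take_poly !coefD coefMX !coefMXn !coefC.
by case: i => [|[|[|[|i]]]]; rewrite /= ?addr0 ?add0r.
Qed.

(** * Gamma in coordinates *)

Section Coordinates.
Variable R : realType.
Local Notation C := (cplx R).
Local Notation M2 := 'M[cplx R]_2.
Local Notation S := (Smx R).

Lemma mx2K (A : M2) : mx2 (A 0 0) (A 0 1) (A 1 0) (A 1 1) = A.
Proof.
apply/matrixP => -[[|[|//]] ?] [[|[|//]] ?]; rewrite mxE /=;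
by congr (A _ _); apply: val_inj.
Qed.

Lemma mx2_inj (a b c d a' b' c' d' : C) :
  mx2 a b c d = mx2 a' b' c' d' -> [/\ a = a', b = b', c = c' & d = d'].
Proof.
move=> /matrixP e; split;
  [move: (e 0 0)|move: (e 0 1)|move: (e 1 0)|move: (e 1 1)];
by rewrite !mxE /=.
Qed.

Lemma mx2D (a b c d a' b' c' d' : C) :
  mx2 a b c d + mx2 a' b' c' d' = mx2 (a + a') (b + b') (c + c') (d + d').
Proof. by apply/matrixP => i j; rewrite !mxE; do 2 case: ifP => _. Qed.

Lemma mx2N (a b c d : C) : - mx2 a b c d = mx2 (- a) (- b) (- c) (- d).
Proof. by apply/matrixP => i j; rewrite !mxE; do 2 case: ifP => _. Qed.

Lemma mx2M (a b c d a' b' c' d' : C) :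
  mx2 a b c d * mx2 a' b' c' d' =
  mx2 (a * a' + b * c') (a * b' + b * d') (c * a' + d * c') (c * b' + d * d').
Proof.
apply/matrixP => i j; rewrite !mxE !big_ord_recl big_ord0 !mxE /= addr0.
by do 2 case: ifP => _.
Qed.

Lemma Smx_sqr : S * S = 0.
Proof.
rewrite /Smx mx2M !(mul0r, mulr0, addr0).
by apply/matrixP => i j; rewrite !mxE; do 2 case: ifP => _.
Qed.

(** The pattern of free and repeated entries in the first four coefficients
    is the relations [gamma_relations] written out entry by entry: commuting
    with [S] makes a matrix upper triangular with equal diagonal entries, and
    the last relation expresses the entries of the coefficient of degree 1. *)
Lemma GammaP (theta : {poly M2}) : Gamma theta <-> gamma_relations S theta.
Proof.
split.
  move=> [a0 [b0 [a1 [b1 [a2 [b2 [d2 [a3 [b3 [d3 [p ->]]]]]]]]]]].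
  have [e0 e1 e2 e3] := coef_cubic_head (mx2 a0 b0 0 a0) (mx2 a1 b1 0 a1)
    (mx2 a2 b2 a1 d2) (mx2 a3 b3 (d2 + a2 - b1) d3) p.
  rewrite /gamma_relations e0 e1 e2 e3 /Smx !mx2M !mx2N !mx2D.
  by split; congr mx2; ring.
move=> [].
set t0 := theta`_0; set t1 := theta`_1; set t2 := theta`_2; set t3 := theta`_3.
rewrite /Smx -(mx2K t0) -(mx2K t1) -(mx2K t2) -(mx2K t3).
rewrite !mx2M !mx2N !mx2D.
rewrite !(mul0r, mulr0, mul1r, mulr1, addr0, add0r, oppr0).
move=> /mx2_inj[_ e0 _ e1] /mx2_inj [_ _ _ e2] /mx2_inj [e3 e4 _ e6].
exists (t0 0 0), (t0 0 1), (t1 0 0), (t1 0 1), (t2 0 0), (t2 0 1), (t2 1 1),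
  (t3 0 0), (t3 0 1), (t3 1 1), (drop_poly 4 theta).
have -> : mx2 (t0 0 0) (t0 0 1) 0 (t0 0 0) = t0.
  by rewrite -[RHS]mx2K -e0 e1.
have -> : mx2 (t1 0 0) (t1 0 1) 0 (t1 0 0) = t1.
  by rewrite -[RHS]mx2K e2 e3 e6.
have -> : mx2 (t2 0 0) (t2 0 1) (t1 0 0) (t2 1 1) = t2.
  by rewrite -[RHS]mx2K e3.
have -> : mx2 (t3 0 0) (t3 0 1) (t2 1 1 + t2 0 0 - t1 0 1) (t3 1 1) = t3.
  by rewrite -[RHS]mx2K e4; congr mx2; ring.
exact: poly_cubic_head.
Qed.

End Coordinates.

(** * The exponential and the derivatives of psi *)

(** The derivative of an exponential times an affine function uses only the
    functional equation of the exponential and its difference quotient at 0. *)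
Section ExponentialLike.
Variables (K : numFieldType) (V : normedModType K) (E : K -> K) (x : K).
Hypothesis ED : forall h z, E (h + z) = E h * E z.
Hypothesis E0 : (fun h => h^-1 * (E h - 1)) @ 0^' --> x.

Lemma exp_like_cvg1 : E @ 0^' --> (1 : K).
Proof.
have h0 : (fun h : K => h) @ 0^' --> (0 : K).
  apply/cvgrPdist_lt => e e0; near=> h; rewrite sub0r normrN; near: h.
  exact: dnbhs0_lt.
have c : ((fun h => h * (h^-1 * (E h - 1))) \+ cst 1) @ 0^' --> (0 * x + 1 : K).
  by apply: cvgD; [exact: cvgM|exact: cvg_cst].
rewrite mul0r add0r in c; apply: (cvg_trans _ c); apply: near_eq_cvg.
near=> h => /=.
have hn0 : h != 0 by near: h; exact: nbhs_dnbhs_neq.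
by rewrite mulVKf // subrK.
Unshelve. all: by end_near. Qed.

Lemma derive1_exp_affine (z : K) (A B : V) :
  derive1 (fun z => E z *: (z *: A + B)) z =
  E z *: (z *: (x *: A) + (x *: B + A)).
Proof.
apply: cvg_lim; first exact: norm_hausdorff.
pose g h := (h^-1 * (E h - 1)) *: (z *: A + B) + E h *: A.
have c : (fun h => E z *: g h) @ 0^' --> E z *: (x *: (z *: A + B) + 1 *: A).
  by apply: cvgZl_tmp; apply: cvgD; apply: cvgZr_tmp => //; exact: exp_like_cvg1.
rewrite scale1r [x *: (_ + _)]scalerDr !scalerA [x * z]mulrC -scalerA -addrA in c.
apply: (cvg_trans _ c); apply: near_eq_cvg.
near=> h => /=.
have h0 : h != 0 by near: h; exact: nbhs_dnbhs_neq.
rewrite ED [E h * _]mulrC.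
rewrite -scalerA -scalerBr scalerA [_^-1 * _]mulrC -scalerA /g; congr (_ *: _).
rewrite scalerDl -[h *: A + _ + _]addrA; move: (z *: A + B) => w.
rewrite [E h *: (_ + _)]scalerDr -addrA -{3}[w]scale1r -scalerBl scalerDr !scalerA.
by rewrite addrC mulrAC mulVf ?mul1r.
Unshelve. all: by end_near. Qed.
End ExponentialLike.

Section ComplexExponential.
Variable R : realType.
Local Notation C := (cplx R).

Lemma expCD (z w : C) : expC (z + w) = expC z * expC w.
Proof.
case: z w => [a b] [c d]; rewrite /expC /= expRD cosD sinD.
by apply/eqP; rewrite eq_complex /=; apply/andP; split; apply/eqP; ring.
Qed.

Lemma expC0 : expC (0 : C) = 1.
Proof. by rewrite /expC /= expR0 cos0 sin0 mulr1 mulr0. Qed.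

Lemma expC_neq0 (z : C) : expC z != 0.
Proof.
apply/eqP => ez; have := expCD z (- z).
by rewrite subrr expC0 ez mul0r => /eqP; rewrite oner_eq0.
Qed.

Lemma first_order_bound (f : R -> R) (l e : R) : is_derive (0 : R) 1 f l -> 0 < e ->
  exists2 d, 0 < d & forall h, `|h| < d -> `|f h - f 0 - l * h| <= e * `|h|.
Proof.
move=> [df <-] e0; move/cvgrPdist_le: df => /(_ e e0) [d /= d0 dP].
exists d => // h hd; have [->|h0] := eqVneq h 0.
  by rewrite subrr mulr0 subr0 normr0 mulr0.
have := dP h; rewrite /= sub0r normrN => /(_ hd h0).
rewrite /= [h%:A]mulr1 addr0 => le.
rewrite -ler_pdivrMr ?normr_gt0 // -normfV -normrM distrC in le *.
by apply: le_trans le; rewrite le_eqVlt; apply/orP; left; apply/eqP; congr (`| _ |);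
  rewrite /derive /GRing.scale /=; field.
Qed.

(** Complex differentiability at 0, from the real derivatives of [expR],
    [cos] and [sin] at 0: for h = u + iv, the real part of the remainder is
    [e^u (cos v - 1) + (e^u - 1 - u)] and the imaginary part is
    [e^u (sin v - v) + (e^u - 1) v]. *)
Lemma expC_first_order (e : R) : 0 < e ->
  exists2 d : R, 0 < d & forall h : C, `|h| < d%:C%C ->
    `|expC h - 1 - h| <= e%:C%C * `|h|.
Proof.
(* Each part is at most 3 k |h|, whence the factor 6; k <= 1 bounds e^u by 2. *)
move=> e0; pose k := Num.min (e / 6) 1.
have k0 : 0 < k by rewrite lt_min divr_gt0 ?ltr01.
have k1 : k <= 1 by rewrite ge_min lexx orbT.
have ke : 6 * k <= e by rewrite mulrC -ler_pdivlMr // ge_min lexx.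
have [d1 d10 /= exp_le] := first_order_bound (is_derive_expR (0 : R)) k0.
have [d2 d20 /= cos_le] := first_order_bound (is_derive_cos (0 : R)) k0.
have [d3 d30 /= sin_le] := first_order_bound (is_derive_sin (0 : R)) k0.
(* |u| < k / 2 makes |e^u - 1| <= |u| + k |u| <= 2 |u| at most k. *)
exists (Num.min (Num.min d1 (k / 2)) (Num.min d2 d3)).
  by rewrite !lt_min d10 d20 d30 divr_gt0.
move=> [u v]; rewrite !normc_def /= -rmorphM /= ltcR lecR.
set N := Num.sqrt _.
rewrite !lt_min => /andP[/andP[N1 Nk] /andP[N2 N3]].
have uN : `|u| <= N by rewrite -sqrtr_sqr ler_wsqrtr // lerDl sqr_ge0.
have vN : `|v| <= N by rewrite -sqrtr_sqr ler_wsqrtr // lerDr sqr_ge0.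
have norm_le (a b : R) : Num.sqrt (a ^+ 2 + b ^+ 2) <= `|a| + `|b|.
  rewrite -[leRHS]ger0_norm ?addr_ge0 // -sqrtr_sqr ler_wsqrtr //.
  rewrite sqrrD !real_normK ?num_real // addrAC lerDl.
  by rewrite mulrn_wge0 // mulr_ge0.
apply: (le_trans (norm_le _ _)).
have {}exp_le := exp_le u (le_lt_trans uN N1).
have {}cos_le := cos_le v (le_lt_trans vN N2).
have {}sin_le := sin_le v (le_lt_trans vN N3).
rewrite expR0 mul1r in exp_le.
rewrite cos0 sin0 oppr0 mul0r subr0 in cos_le.
rewrite sin0 cos0 subr0 mul1r in sin_le.
have kN : k * `|v| <= k * N by rewrite ler_pM2l.
have kN' : k * `|u| <= k * N by rewrite ler_pM2l.
have exp1 : `|expR u - 1| <= k.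
  rewrite -[_ - 1](subrK u) (le_trans (ler_normD _ _)) //.
  by nra.
have exp2 : `|expR u| <= 2.
  by rewrite -[expR u](subrK 1) (le_trans (ler_normD _ _)) // normr1; lra.
have a_le : `|expR u * cos v - 1 - u| <= 3 * (k * N).
  rewrite (_ : _ - u = expR u * (cos v - 1) + (expR u - 1 - u)); last by ring.
  rewrite (le_trans (ler_normD _ _)) // normrM.
  have : `|expR u| * `|cos v - 1| <= 2 * (k * `|v|) by rewrite ler_pM.
  by lra.
have b_le : `|expR u * sin v - 0 - v| <= 3 * (k * N).
  rewrite (_ : _ - v = expR u * (sin v - v) + (expR u - 1) * v); last by ring.
  rewrite (le_trans (ler_normD _ _)) // !normrM.
  have : `|expR u| * `|sin v - v| <= 2 * (k * `|v|) by rewrite ler_pM.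
  have : `|expR u - 1| * `|v| <= k * `|v| by rewrite ler_pM.
  by lra.
have N0 : 0 <= N by rewrite sqrtr_ge0.
have : 6 * k * N <= e * N by rewrite ler_wpM2r.
by lra.
Qed.
End ComplexExponential.

Section DifferenceQuotient.
Variable R : realType.
Local Notation C := (cplx R).
Local Notation M2 := 'M[cplx R]_2.

Lemma cplx_gt0P (e : C) : 0 < e -> exists2 r : R, 0 < r & e = r%:C%C.
Proof. by case: e => a b; rewrite ltcE /= => /andP[/eqP -> a0]; exists a. Qed.

Lemma expC_difference_quotient (x : C) :
  (fun h : C => h^-1 * (expC (x * h) - 1)) @ 0^' --> x.
Proof.
apply/cvgrPdist_le => _ /cplx_gt0P[e e0 ->].
have [->|x0] := eqVneq x 0.
  near=> h; rewrite mul0r expC0 subrr mulr0 subr0 normr0.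
  by rewrite (lecR 0 e) ltW.
have [a a0 xa] : exists2 a : R, 0 < a & `|x| = a%:C%C.
  by apply: cplx_gt0P; rewrite normr_gt0.
have [d d0 dP] := expC_first_order (divr_gt0 e0 a0).
near=> h.
have h0 : h != 0 by near: h; exact: nbhs_dnbhs_neq.
have hd : `|x * h| < d%:C%C.
  rewrite normrM -ltr_pdivlMl ?normr_gt0 //; near: h; apply: dnbhs0_lt.
  by rewrite mulr_gt0 // ?invr_gt0 ?normr_gt0 // (ltcR 0 d).
have := dP _ hd.
rewrite normrM xa mulrA -rmorphM /= divfK ?gt_eqF // => le.
rewrite (_ : _ - _ = - (h^-1 * (expC (x * h) - 1 - x * h))); last by field.
by rewrite normrN normrM normfV ler_pdivrMl ?normr_gt0 // [leRHS]mulrC.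
Unshelve. all: by end_near. Qed.

End DifferenceQuotient.

Section WaveFunction.
Variable R : realType.
Local Notation C := (cplx R).
Local Notation M2 := 'M[cplx R]_2.
Local Notation S := (Smx R).
Implicit Types (x z : C) (theta p q : {poly M2}).

(** For j = 0 the exponent [j.-1] is a junk value, harmless since it comes with
    the factor [j%:R = 0]. *)
Lemma derive1n_psi j x :
  derive1n j (psi x) = fun z => expC (x * z) *:
    (z *: (x ^+ j)%:M + (x ^+ j *: (- (x^-1)%:M + x ^- 2 *: S) + (j%:R * x ^+ j.-1)%:M)).
Proof.
elim: j => [|j IH].
  apply/funext => z; rewrite /= /psi expr0 scale1r mul0r raddf0 addr0 addrA.
  by rewrite scalemx1.
rewrite derive1nS IH; apply/funext => z.
have ED h w : expC (x * (h + w)) = expC (x * h) * expC (x * w).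
  by rewrite mulrDr expCD.
rewrite (derive1_exp_affine (E := fun z => expC (x * z)) ED
  (@expC_difference_quotient R x)).
congr (_ *: _); rewrite [x *: (x ^+ j)%:M]scale_scalar_mx -exprS; congr (_ + _).
rewrite scalerDr scalerA -exprS -addrA; congr (_ + _).
rewrite [x *: _%:M]scale_scalar_mx -raddfD /=; congr (_%:M).
case: j {IH} => [|j]; first by rewrite mul0r mulr0 add0r mul1r.
by rewrite mulrCA -exprS [j.+2%:R]mulrS mulrDl mul1r addrC.
Qed.

Lemma mul_psi theta x z : x != 0 ->
  theta.[x%:M] * psi x z = (expC (x * z) / x ^+ 2) *: (theta * wave_poly S z).[x%:M].
Proof.
move=> x0; rewrite /psi -[x%:M]scalemx1 -[z%:M]scalemx1 -[x^-1%:M]scalemx1 scaled_wave //.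
by rewrite -scalerAr horner_scalarM.
Qed.

Lemma psi_actE m (b : 'I_m.+1 -> C -> M2) x z : x != 0 ->
  psi_act b x z = (expC (x * z) / x ^+ 2) *:
    (symbol S z (\poly_(j < m.+1) b (inord j) z)).[x%:M].
Proof.
move=> x0; rewrite -scalemx1 -scaled_symbol // /psi_act.
apply: eq_bigr => j _; rewrite inord_val derive1n_psi -[x^-1%:M]scalemx1.
by rewrite -[(x ^+ j)%:M]scalemx1 -[(_ * _)%:M]scalemx1.
Qed.
End WaveFunction.

(** * Holomorphic and meromorphic functions *)

Section Holomorphy.
Variables (K : numFieldType) (W : normedModType K).

Lemma derivable_scale (s : K -> K) (g : K -> W) z :
  derivable s z 1 -> derivable g z 1 -> derivable (fun w => s w *: g w) z 1.
Proof.
move=> /cvg_ex[s' ds] dg; have gc := dg; move/cvg_ex: dg => [g' dg].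
have {}gc : (g \o shift z) @ 0^' --> g z.
  apply/continuous_withinNshiftx/differentiable_continuous.
  exact/derivable1_diffP.
pose q h := (h^-1 *: ((s \o shift z) (h *: 1) - s z)) *: (g \o shift z) h
  + s z *: (h^-1 *: ((g \o shift z) (h *: 1) - g z)).
apply/cvg_ex; exists (s' *: g z + s z *: g').
have c : q @ 0^' --> s' *: g z + s z *: g'.
  by apply: cvgD; [exact: cvgZ|exact: cvgZl_tmp].
rewrite (_ : (fun h => _) = q) //; apply/funext => h; rewrite /q /=.
have -> : h *: 1 = h by exact: mulr1.
rewrite -[(h^-1 *: _) *: _]scalerA scalerBl scalerA [s z * _]mulrC -scalerA.
by rewrite -scalerDr [s z *: (_ - _)]scalerBr addrA subrK.
Qed.

Lemma derivable_monomial (v : W) n (z : K) :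
  derivable (fun w : K => w ^+ n *: v) z 1.
Proof.
by apply: (@derivable_scale (fun w => w ^+ n) (cst v));
  [exact: exprn_derivable|exact: derivable_cst].
Qed.

Lemma near_neq (a z : K) : z != a -> \forall w \near z, w != a.
Proof.
rewrite -subr_eq0 => za; apply/nbhs_ballP; exists `|z - a|.
  by rewrite /= normr_gt0.
by move=> w; rewrite -ball_normE /=; apply: contraTneq => ->; rewrite ltxx.
Qed.

(** A punctured neighbourhood is a neighbourhood of each of its points. *)
Lemma dnbhs_join (a : K) (P : set K) :
  (\forall z \near a^', P z) -> \forall z \near a^', \forall w \near z, P w.
Proof.
move=> /nbhs_interior Pa; rewrite near_withinE; near=> z => za.
have Pz : \forall w \near z, w != a -> P w by near: z.
by near=> w; apply: (near Pz w) => //; near: w; exact: near_neq.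
Unshelve. all: by end_near. Qed.

Lemma derivable_inv_power n (a z : K) : z != a ->
  derivable (fun w : K => (w - a) ^- n) z 1.
Proof.
move=> za; have dV : derivable (fun w : K => (w - a)^-1) z 1.
  apply: derivableV; first by rewrite subr_eq0.
  exact: (@ex_derive _ _ _ _ _ _ _ (is_derive_shift z 1 (- a))).
elim: n => [|n IH].
  by under eq_fun do rewrite expr0 invr1; exact: derivable_cst.
rewrite (_ : (fun w => _) = (fun w => (w - a)^-1 * (w - a) ^- n)); last first.
  by apply/funext => w; rewrite exprS invfM.
by apply: derivableM.
Qed.

Lemma derivable_of_pole (f g : K -> W) n (a z : K) : z != a ->
  (\forall w \near z, (w - a) ^+ n *: f w = g w) ->
  derivable g z 1 -> derivable f z 1.
Proof.
move=> za fg dg.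
apply: (@near_eq_derivable _ _ _ (fun w => (w - a) ^- n *: g w)).
  near=> w.
  have wa : w != a by near: w; exact: near_neq.
  have <- : (w - a) ^+ n *: f w = g w by near: w.
  by rewrite scalerA mulVf ?scale1r // expf_neq0 // subr_eq0.
by apply: derivable_scale => //; exact: derivable_inv_power.
Unshelve. all: by end_near. Qed.

End Holomorphy.

Section Domains.
Variable R : realType.
Local Notation C := (cplx R).
Local Notation M2 := 'M[cplx R]_2.

Lemma meromorphic_at_regular (W : normedModType C) (f : C -> W) a :
  meromorphic_at f a -> \forall z \near a^', holomorphic_at f z.
Proof.
move=> [n [g [hg fg]]].
have {}hg : \forall z \near a^', derivable g z 1 by exact: nbhs_dnbhs.
have := dnbhs_join fg => {}fg.
have P : \forall z \near a^', derivable f z 1.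
  near=> z; apply: (@derivable_of_pole _ _ f g n a z); near: z => //.
  exact: nbhs_dnbhs_neq.
exact: dnbhs_join P.
Unshelve. all: by end_near. Qed.

Lemma regular_near m (b : 'I_m.+1 -> C -> M2) a :
  (forall j, meromorphic_at (b j) a) -> \forall z \near a^', regular_point b z.
Proof. by move=> mb; apply: filter_forall => j; exact: meromorphic_at_regular. Qed.

(** Supplies the two values of [z] needed in [gamma_relations_of_symbol]. *)
Lemma dnbhs_two_points (a : C) (P : set C) : (\forall z \near a^', P z) ->
  exists z1 z2, [/\ P z1, P z2, z1 != 0 & z1 != z2].
Proof.
have neq (c : C) : \forall z \near a^', z != c.
  have [->|ca] := eqVneq c a; first exact: nbhs_dnbhs_neq.
  by apply: nbhs_dnbhs; apply: near_neq; rewrite eq_sym.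
move=> Pa.
have [z1 [P1 z10]] : exists z, P z /\ z != 0.
  by apply: (@filter_ex _ a^'); exact: (filterI Pa (neq 0)).
have [z2 [P2 z12]] : exists z, P z /\ z != z1.
  by apply: (@filter_ex _ a^'); exact: (filterI Pa (neq z1)).
by exists z1, z2; split => //; rewrite eq_sym.
Qed.

(** Away from 0 such an [f] is holomorphic; the power of [z] is needed at 0 only. *)
Lemma meromorphic_of_laurent (W : normedModType C) (f g : C -> W) n (a : C) :
  (forall z, derivable g z 1) -> (forall z, z != 0 -> z ^+ n *: f z = g z) ->
  meromorphic_at f a.
Proof.
move=> dg fg; have [->|a0] := eqVneq a 0.
  exists n, g; split; first by near=> z; exact: dg.
  near=> z; rewrite subr0 fg //.
  by near: z; exact: nbhs_dnbhs_neq.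
exists 0%N, f; split; last by near=> z; rewrite expr0 scale1r.
near=> z.
have z0 : z != 0 by near: z; exact: near_neq.
apply: (@derivable_of_pole _ _ f g n 0 z z0 _ (dg z)).
by apply: filterS (near_neq z0) => w w0; rewrite subr0 fg.
Unshelve. all: by end_near. Qed.

(** The set is the union of the segments from [c] to its points. *)
Lemma star_shaped_connected (A : set C) (c : C) : A c ->
  (forall z (t : R), A z -> 0 <= t <= 1 -> A (c + t%:C%C * (z - c))) ->
  connected A.
Proof.
move=> Ac star.
pose seg z := [set c + t%:C%C * (z - c) | t in `[0, 1]%classic].
have -> : A = \bigcup_(z in A) seg z.
  apply/seteqP; split=> [z Az|w [z Az [t]]].
    exists z => //; exists 1; first by rewrite /= in_itv /= ler01 lexx.
    by rewrite (rmorph1 (real_complex R)) mul1r addrC subrK.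
  by rewrite /= in_itv /= => t01 <-; exact: star.
apply: bigcup_connected.
  exists c => z Az; exists 0; first by rewrite /= in_itv /= ler01 lexx.
  by rewrite (rmorph0 (real_complex R)) mul0r addr0.
move=> z Az; apply: connected_continuous_connected.
  exact: segment_connected.
apply: continuous_subspaceT => t.
apply/cvgrPdist_lt => _ /cplx_gt0P[e e0 ->].
have [r r0 rE] : exists2 r : R, 0 <= r & `|z - c| = r%:C%C.
  by exists (Num.sqrt (complex.Re (z - c) ^+ 2 + complex.Im (z - c) ^+ 2));
    [exact: sqrtr_ge0|exact: normc_def].
have r1 : 0 < r + 1 by rewrite ltr_wpDl.
have := nbhsx_ballx t (e / (r + 1)) (divr_gt0 e0 r1).
apply: filterS => u; rewrite -ball_normE /= => tu.
rewrite opprD addrACA subrr add0r -mulrBl -rmorphB normrM rE.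
rewrite normc_def /= expr0n addr0 sqrtr_sqr -rmorphM (ltcR (_ * _) e).
apply: (@le_lt_trans _ _ (`|t - u| * (r + 1))); first by rewrite ler_wpM2l ?lerDl.
by rewrite -ltr_pdivlMr.
Qed.

Lemma connected_cplx : connected [set: C].
Proof. exact: (star_shaped_connected (c := 0)). Qed.

Lemma connected_cplx_ball (c r : C) : 0 < r -> connected (ball c r).
Proof.
move=> r0; apply: (star_shaped_connected (c := c)); first exact: ballxx.
move=> z t; rewrite -!ball_normE /= => zr /andP[t0 t1].
rewrite opprD addrA subrr sub0r normrN normrM distrC in zr *.
rewrite (le_lt_trans _ zr) // ler_piMl // normc_def /=.
rewrite expr0n addr0 sqrtr_sqr ger0_norm //.
by rewrite (lecR t 1).
Qed.

End Domains.

(** * The bispectral algebra *)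

Section Bispectrality.
Variable R : realType.
Local Notation C := (cplx R).
Local Notation M2 := 'M[cplx R]_2.
Local Notation S := (Smx R).
Implicit Types (x z : C) (theta p q : {poly M2}).

(** Each matrix entry is a scalar polynomial vanishing at 1, 2, 3, and so on. *)
Lemma poly_mx_eq0 p : (forall x, x != 0 -> p.[x%:M] = 0) -> p = 0.
Proof.
move=> p0; apply/polyP => k; rewrite coef0; apply/matrixP => i j; rewrite mxE.
pose q := \poly_(l < size p) p`_l i j.
suff q0 : q = 0.
  have := congr1 (fun r : {poly C} => r`_k) q0.
  by rewrite coef_poly coef0; case: ltnP => // /(nth_default 0) -> _; rewrite mxE.
have root_q x : x != 0 -> root q x.
  move=> x0; apply/rootP; rewrite horner_poly.
  have := congr1 (fun A : M2 => A i j) (p0 x x0).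
  rewrite mxE -[X in X.[_]]coefK -[x%:M]scalemx1 horner_poly_scalar.
  rewrite summxE => e; rewrite -[RHS]e.
  by apply: eq_bigr => l _; rewrite mxE mulrC.
apply/eqP/negP => /negP qn0.
pose rs : seq C := [seq n.+1%:R | n <- iota 0 (size q)].
have := max_poly_roots (rs := rs) qn0.
rewrite size_map size_iota ltnn => no_room; suff: false by [].
apply: no_room.
  by apply/allP => _ /mapP[n _ ->]; apply: root_q; rewrite pnatr_eq0.
by rewrite map_inj_uniq ?iota_uniq // => m n /eqP; rewrite eqr_nat eqSS => /eqP.
Qed.

Lemma poly_mx_inj p q :
  (forall x, x != 0 -> p.[x%:M] = q.[x%:M]) -> p = q.
Proof.
move=> pq; apply/eqP; rewrite -subr_eq0; apply/eqP/poly_mx_eq0 => x x0.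
by rewrite hornerD hornerN pq // subrr.
Qed.

(** The common factor [exp (x z) / x^2] is invertible, and polynomials that
    agree at all nonzero scalars are equal. *)
Lemma psi_act_eqP m (b : 'I_m.+1 -> C -> M2) theta z :
  (forall x, x != 0 -> psi_act b x z = theta.[x%:M] * psi x z) <->
  symbol S z (\poly_(j < m.+1) b (inord j) z) = theta * wave_poly S z.
Proof.
split=> [e|e x x0]; last by rewrite psi_actE // mul_psi // e.
apply: poly_mx_inj => x x0.
have := e x x0; rewrite psi_actE // mul_psi // => /scalerI.
rewrite mulf_neq0 ?expC_neq0 ?invr_neq0 ?expf_neq0 // => /(_ isT).
exact.
Qed.

Lemma bispectral_sub_Gamma theta : bispectral_algebra theta -> Gamma theta.
Proof.
move=> [U [m [b [[Uo [a Ua] _ mb] e]]]].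
have : \forall z \near a^', U z /\ regular_point b z.
  apply: filterI; last by apply: regular_near => j; exact: mb.
  by apply: nbhs_dnbhs; exact: open_nbhs_nbhs.
move=> /dnbhs_two_points[z1 [z2 [[U1 r1] [U2 r2] z10 z12]]].
apply/GammaP; apply: (gamma_relations_of_symbol (Smx_sqr R) z10 z12).
  by apply/psi_act_eqP => x x0; exact: e.
by apply/psi_act_eqP => x x0; exact: e.
Qed.

Section Explicit.
Variables (M : nat) (a : nat -> M2).
Local Notation theta := (\poly_(j < M.+1) a j).
Local Notation B := (Bcoef a theta).

Lemma coef_theta_eq0 k : (M < k)%N -> theta`_k = 0.
Proof. by move=> Mk; rewrite coef_poly ltnS leqNgt Mk. Qed.

Lemma Pseq_eq0 k : (M <= k)%N -> Pseq S theta k = 0.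
Proof.
move=> Mk; rewrite /Pseq !coef_theta_eq0 ?ltnS ?leqW //.
by rewrite mul0rn mul0r mulr0 !subr0.
Qed.

Lemma explicit_operator x z : Gamma theta -> x != 0 -> z != 0 ->
  psi_act (B : 'I_M.+1 -> _) x z = theta.[x%:M] * psi x z.
Proof.
move=> /GammaP gth x0 z0; apply: (psi_act_eqP _ _ _).2 x0.
apply: (gamma_relations_symbol (Smx_sqr R) z0 gth Pseq_eq0) => k.
have [kM|Mk] := leqP k M.
  rewrite coef_poly ltnS kM BcoefE ?inordK //; last exact: coef_theta_eq0.
  by rewrite coef_poly ltnS kM.
rewrite coef_poly ltnS leqNgt Mk coef_theta_eq0 // add0r /correction big1 // => n _.
by rewrite (iter_shift_op_eq0 _ Pseq_eq0) ?scaler0 // (leq_trans (ltnW Mk)) ?leq_addr.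
Qed.

Lemma Bcoef_meromorphic (j : 'I_M.+1) c : meromorphic_at (B j) c.
Proof.
pose v n := iter n (shift_op S) (Pseq S theta) j.
pose g z := z ^+ M *: a j + \sum_(n < M) z ^+ (M - n.+1) *: ((-1) ^+ n.+1 *: v n).
apply: (@meromorphic_of_laurent _ _ _ g M) => [z|z z0].
  apply: derivableD; first exact: derivable_monomial.
  rewrite (_ : (fun _ => _) =
    \sum_(n < M) (fun w : C => w ^+ (M - n.+1) *: ((-1) ^+ n.+1 *: v n))).
    by apply: derivable_sum => n; exact: derivable_monomial.
  by apply/funext => w; rewrite fct_sumE.
rewrite BcoefE; last exact: coef_theta_eq0.
rewrite scalerDr /g scaler_sumr; congr (_ + _); apply: eq_bigr => n _.
rewrite !scalerA -/(v n); congr (_ *: _).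
rewrite mulrCA mulrC; congr (_ * _).
by rewrite -{1}(subnK (ltn_ord n)) exprD mulfK // expf_neq0.
Qed.

End Explicit.
End Bispectrality.

Theorem corollary7 (R : realType) :
  [/\ is_subalgebra (@Gamma R),
      @Gamma R = @bispectral_algebra R &
      forall theta : {poly 'M[cplx R]_2}, @Gamma R theta ->
      forall (M : nat) (a : nat -> 'M[cplx R]_2),
        theta = \poly_(j < M.+1) a j ->
        is_diffop setT (@Bcoef R M a theta) /\
        forall x z : cplx R, x != 0 -> z != 0 ->
          psi_act (@Bcoef R M a theta) x z = theta.[x%:M] * psi x z].
Proof.
have explicit theta : @Gamma R theta ->
      forall (M : nat) (a : nat -> 'M[cplx R]_2),
        theta = \poly_(j < M.+1) a j ->
        is_diffop setT (@Bcoef R M a theta) /\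
        forall x z : cplx R, x != 0 -> z != 0 ->
          psi_act (@Bcoef R M a theta) x z = theta.[x%:M] * psi x z.
  move=> gth M a thE; rewrite thE in gth *; split=> [|x z x0 z0].
    split; [exact: openT|by exists 0|exact: connected_cplx|].
    by move=> j c _; exact: Bcoef_meromorphic.
  exact: explicit_operator.
split=> //.
  split=> [|c p q /GammaP gp /GammaP gq|p q /GammaP gp /GammaP gq]; apply/GammaP.
  - exact: gamma_relations1.
  - by rewrite -scalemx1; exact: gamma_relations_scale.
  - exact: (gamma_relations_mul (Smx_sqr R)).
apply/seteqP; split=> [theta gth|theta]; last exact: bispectral_sub_Gamma.
have [//|[_ _ _ mB] e] := explicit theta gth (size theta).-1 (nth 0 theta) _.
  apply/polyP => k; rewrite coef_poly; case: ltnP => // sk.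
  by rewrite nth_default // (leq_trans (leqSpred _)).
(* The definition asks for the equation at every regular point of the domain,
   and 0 may be one of them, so the domain must exclude it. *)
exists (ball (1 : cplx R) 1), (size theta).-1, (Bcoef (nth 0 theta) theta).
split.
  split; [exact: ball_open|by exists 1; exact: ballxx|exact: connected_cplx_ball|].
  by move=> j z _; exact: mB.
move=> x z x0 z1 _; apply: e => //.
apply/eqP => zE; move: z1; rewrite zE -ball_normE /= subr0 normr1.
by rewrite ltxx.
Qed.
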